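(* Let $i\ge 0$ and let $\mathcal{I}=(I_n)_{n\in\mathbb{N}}$ be any $\mathrm{Inc}(\mathbb{N})^i$-invariant filtration of graded ideals. Then the bigraded Hilbert series $H_{\mathcal{I}}(s,t)$ of $\mathcal{I}$ is a rational function of the form $$H_{\mathcal{I}}(s,t)=\frac{g(s,t)}{(1-t)^a\cdot\prod_{j=1}^b[(1-t)^{c_j}-s\cdot f_j(t)]},$$ where $a,b,c_j$ are non-negative integers with $c_j\le c$, $g(s,t)\in\mathbb{Z}[s,t]$, and each $f_j(t)$ is a polynomial in $\mathbb{Z}[t]$ satisfying $f_j(1)>0$.
   Context: $K$ is an arbitrary field, $c\ge 1$ a fixed integer, $\mathbb{N}=\{1,2,\ldots\}$. For $n\in\mathbb{N}$ let $X_n=\{x_{j,k}\mid 1\le j\le c,\ 1\le k\le n\}$ and $X=\bigcup_{n\ge1}X_n$; $K[X_n]\subset K[X]$ are the polynomial rings over $K$ with the standard grading, $[M]_j$ denotes the degree $j$ component of a graded module $M$. $\mathrm{Inc}(\mathbb{N})$ is the monoid of strictly increasing functions $\mathbb{N}\to\mathbb{N}$; for $i\ge 0$, $\mathrm{Inc}(\mathbb{N})^i=\{\pi\in\mathrm{Inc}(\mathbb{N})\mid \pi(j)=j \text{ for all } j\le i\}$, acting on $K[X]$ by $K$-algebra homomorphisms via $\pi\cdot x_{j,k}=x_{j,\pi(k)}$. For $m\le n$ put $\mathrm{Inc}(\mathbb{N})^i_{m,n}=\{\pi\in\mathrm{Inc}(\mathbb{N})^i\mid\pi(m)\le n\}$.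 An $\mathrm{Inc}(\mathbb{N})^i$-invariant filtration is a sequence $\mathcal{I}=(I_n)_{n\in\mathbb{N}}$ of ideals $I_n\subset K[X_n]$ such that $\mathrm{Inc}(\mathbb{N})^i_{m,n}(I_m)\subset I_n$ whenever $m\le n$. The bigraded Hilbert series of a filtration of graded ideals is the formal power series $H_{\mathcal{I}}(s,t)=\sum_{n\ge0,\,j\ge0}\dim_K[K[X_n]/I_n]_j\cdot s^nt^j$, with $I_0=0$ and $K[X_0]=K$. *)

(* Defs.v *)
From HB Require Import structures.
From Stdlib Require Import ClassicalEpsilon.
From mathcomp Require Import all_boot all_order all_algebra.
From mathcomp.multinomials Require Import mpoly.

Set Implicit Arguments.
Unset Strict Implicit.
Unset Printing Implicit Defensive.

Import GRing.Theory.
Local Open Scope ring_scope.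

(* K[X_n], a polynomial ring in the c * n variables x_{j,k}, 1 <= j <= c and
   1 <= k <= n; the variable x_{j,k} has index [mxvec_index j' k'], where
   j' : 'I_c and k' : 'I_n have values j - 1 and k - 1. *)
Notation polyKX K c n := {mpoly K[(c * n)%N]}.

(* x_{j,k} as an element of K[X_n], for a 1-based k (junk value 0 unless
   1 <= k <= n). *)
Definition xvar (K : fieldType) (c n : nat) (j : 'I_c) (k : nat) : polyKX K c n :=
  if k is k'.+1 then oapp (fun l : 'I_n => 'X_(mxvec_index j l)) 0 (insub k')
  else 0.

(* Inc(N)^i with N = {1, 2, ...}: a function N -> N is encoded as a function
   nat -> nat with value 0 at 0. The condition pi 0 = 0 is the case k = 0 of the
   second clause, and makes the first one say that pi is strictly increasing
   on {1, 2, ...} with positive values. *)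
Definition Inc (i : nat) (pi : nat -> nat) : Prop :=
  (forall k l : nat, (k < l)%N -> (pi k < pi l)%N) /\
  (forall k : nat, (k <= i)%N -> pi k = k).

Definition Inc_mn (i m n : nat) (pi : nat -> nat) : Prop :=
  Inc i pi /\ (pi m <= n)%N.

(* The K-algebra homomorphism K[X_m] -> K[X_n], x_{j,k} |-> x_{j,pi(k)}: the
   action of pi restricted to K[X_m], provided pi(m) <= n. *)
Definition inc_act (K : fieldType) (c m n : nat) (pi : nat -> nat)
    (p : polyKX K c m) : polyKX K c n :=
  p \mPo [tuple mxvec (\matrix_(j < c, k < m) xvar K n j (pi k.+1)) 0 l
         | l < (c * m)%N].

Lemma inc_act_xvar (K : fieldType) (c m n : nat) (pi : nat -> nat)
    (j : 'I_c) (k : nat) :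
  (0 < k <= m)%N -> inc_act n pi (xvar K m j k) = xvar K n j (pi k).
Proof.
case: k => // k /= lekm; rewrite /inc_act insubT /=.
by rewrite comp_mpolyXU -tnth_nth tnth_mktuple mxvecE mxE.
Qed.

(* Unlike [idealr_closed], the unit ideal is allowed. *)
Definition is_ideal (R : comNzRingType) (I : R -> Prop) : Prop :=
  [/\ I 0, (forall p q, I p -> I q -> I (p + q))
    & (forall a p, I p -> I (a * p))].

Definition is_graded (K : fieldType) (N : nat) (I : {mpoly K[N]} -> Prop) : Prop :=
  forall (d : nat) (p : {mpoly K[N]}), I p -> I (pihomog mdeg d p).

(* The filtration is indexed by nat, with the convention I_0 = 0. *)
Record inc_filtration (K : fieldType) (c i : nat)
    (I : forall n : nat, polyKX K c n -> Prop) : Prop := IncFiltration {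
  filtration0 : forall p : polyKX K c 0, I 0%N p <-> p = 0;
  filtration_ideal : forall n : nat, is_ideal (I n);
  filtration_inc : forall (m n : nat) (pi : nat -> nat) (p : polyKX K c m),
    (m <= n)%N -> Inc_mn i m n pi -> I m p -> I n (inc_act n pi p)
}.

(* The classes of the v_l form a K-basis of [K[x_1,...,x_N] / I]_d. *)
Definition quot_basis (K : fieldType) (N : nat) (I : {mpoly K[N]} -> Prop)
    (d r : nat) (v : 'I_r -> {mpoly K[N]}) : Prop :=
  [/\ forall l : 'I_r, v l \is d.-homog,
      forall a : 'I_r -> K, I (\sum_l a l *: v l) -> forall l, a l = 0
    & forall p : {mpoly K[N]}, p \is d.-homog ->
        exists a : 'I_r -> K, I (p - \sum_l a l *: v l)].

(* dim_K [K[x_1,...,x_N] / I]_d; see [quot_dimP] and [quot_dim_eq]. *)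
Definition quot_dim (K : fieldType) (N : nat) (I : {mpoly K[N]} -> Prop)
    (d : nat) : nat :=
  epsilon (inhabits 0%N) (fun r => exists v : 'I_r -> {mpoly K[N]}, quot_basis I d v).

Section QuotDim.
Variables (K : fieldType) (N : nat) (I : {mpoly K[N]} -> Prop).
Hypothesis idI : is_ideal I.

Let I0 : I 0. Proof. by case: idI. Qed.
Let ID p q : I p -> I q -> I (p + q). Proof. by case: idI => _ h _; apply: h. Qed.
Let IM a p : I p -> I (a * p). Proof. by case: idI => _ _ h; apply: h. Qed.
Let IZ (a : K) p : I p -> I (a *: p).
Proof. by rewrite -mul_mpolyC; apply: IM. Qed.
Let IN p : I p -> I (- p). Proof. by rewrite -scaleN1r; apply: IZ. Qed.
Let IB p q : I p -> I q -> I (p - q).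
Proof. by move=> Ip Iq; apply: ID => //; apply: IN. Qed.
Let Isum (T : finType) (F : T -> {mpoly K[N]}) :
  (forall x, I (F x)) -> I (\sum_x F x).
Proof. by move=> IF; elim/big_ind: _ => // x y; apply: ID. Qed.

Lemma quot_basis_le (d r s : nat) (v : 'I_r -> {mpoly K[N]})
    (w : 'I_s -> {mpoly K[N]}) :
  quot_basis I d v -> quot_basis I d w -> (r <= s)%N.
Proof.
move=> [hv fv gv] [hw fw gw].
have [A hA] : exists A : 'I_r -> 'I_s -> K,
    forall l, I (v l - \sum_k A l k *: w k).
  have H l : {a : 'I_s -> K | I (v l - \sum_k a k *: w k)}.
    by apply: constructive_indefinite_description; apply: gw.
  by exists (fun l => sval (H l)) => l; case: (H l).
have [B hB] : exists B : 'I_s -> 'I_r -> K,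
    forall k, I (w k - \sum_l B k l *: v l).
  have H k : {a : 'I_r -> K | I (w k - \sum_l a l *: v l)}.
    by apply: constructive_indefinite_description; apply: gv.
  by exists (fun k => sval (H k)) => k; case: (H k).
pose MA := \matrix_(l < r, k < s) A l k; pose MB := \matrix_(k < s, l < r) B k l.
suff AB1 : MA *m MB = 1%:M by apply: mulmx1_min AB1.
apply/matrixP => l l'; apply/eqP; rewrite -subr_eq0; apply/eqP.
pose a l' := (MA *m MB) l l' - (1%:M : 'M[K]_r) l l'.
rewrite -/(a l'); move: l'; apply: fv.
have -> : \sum_l' a l' *: v l' =
   - (v l - \sum_k A l k *: w k)
   - \sum_k A l k *: (w k - \sum_l' B k l' *: v l').
  rewrite /a; under eq_bigr do rewrite scalerBl.
  rewrite sumrB.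
  have -> : \sum_l' (1%:M : 'M[K]_r) l l' *: v l' = v l.
    rewrite (bigD1 l) //= big1 ?addr0 ?mxE ?eqxx ?scale1r // => l' ne.
    by rewrite mxE eq_sym (negbTE ne) scale0r.
  under [X in _ = _ - X]eq_bigr do rewrite scalerBr.
  rewrite sumrB.
  have -> : \sum_l' (MA *m MB) l l' *: v l' =
            \sum_k A l k *: \sum_l' B k l' *: v l'.
    under eq_bigr do rewrite mxE scaler_suml.
    rewrite exchange_big /=; apply: eq_bigr => k _.
    rewrite scaler_sumr; apply: eq_bigr => l' _.
    by rewrite !mxE scalerA.
  by rewrite !opprB [RHS]addrC addrA subrK.
apply: IB; first exact: IN.
by apply: Isum => k; apply: IZ.
Qed.

Lemma quot_dim_exists (d : nat) :
  exists r, exists v : 'I_r -> {mpoly K[N]}, quot_basis I d v.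
Proof.
pose spn r (v : 'I_r -> {mpoly K[N]}) p :=
  exists a : 'I_r -> K, I (p - \sum_l a l *: v l).
have key (s : seq {mpoly K[N]}) : all (fun p => p \is d.-homog) s ->
    exists r (v : 'I_r -> {mpoly K[N]}),
      [/\ forall l, v l \is d.-homog,
          forall a : 'I_r -> K, I (\sum_l a l *: v l) -> forall l, a l = 0
        & forall p, p \in s -> spn r v p].
  elim: s => [_|x s IHs /= /andP[hx /IHs [r [v [hv fv gv]]]]].
    by exists 0%N, (fun=> 0); split=> // [[] // | ? ? []].
  case: (classic (spn r v x)) => [sx|nsx].
    exists r, v; split=> // p; rewrite inE => /predU1P [->|] //; exact: gv.
  exists r.+1, (fun l => oapp v x (unlift ord0 l)).
  have sumE (a : 'I_r.+1 -> K) :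
      \sum_l a l *: oapp v x (unlift ord0 l)
      = a ord0 *: x + \sum_l a (lift ord0 l) *: v l.
    rewrite big_ord_recl unlift_none /=; congr (_ + _).
    by apply: eq_bigr => l _; rewrite liftK.
  split=> [l|a|p].
  - by case: (unlift ord0 l) => [k|] /=; [apply: hv | apply: hx].
  - rewrite sumE => Ia.
    have a00 : a ord0 = 0.
      apply/eqP/negP => /negP nz; apply: nsx.
      exists (fun l => - (a ord0)^-1 * a (lift ord0 l)).
      move: Ia => /(IZ (a ord0)^-1).
      rewrite scalerDr scalerA mulVf // scale1r scaler_sumr -sumrN.
      congr (I (_ + _)); apply: eq_bigr => l _.
      by rewrite scalerA mulNr scaleNr opprK.
    move: Ia; rewrite a00 scale0r add0r => /fv a0 l.
    by case: (unliftP ord0 l) => [k ->|->].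
  - rewrite inE => /predU1P [->|/gv [a Ia]].
      exists (fun l => (l == ord0)%:R); rewrite sumE eqxx scale1r big1 ?addr0.
        by rewrite subrr.
      by move=> l _; rewrite eq_sym (negbTE (neq_lift _ _)) scale0r.
    exists (fun l => oapp a 0 (unlift ord0 l)); rewrite sumE unlift_none /=.
    rewrite scale0r add0r.
    by under eq_bigr do rewrite liftK.
pose s := [seq ('X_[bmnm m] : {mpoly K[N]})
          | m <- enum [pred m : 'X_{1..N < d.+1} | mdeg m == d]].
have hs : all (fun p => p \is d.-homog) s.
  by apply/allP => p /mapP [m]; rewrite mem_enum inE => /eqP dm ->; rewrite dhomogX /= dm.
have [r [v [hv fv gv]]] := key s hs.
exists r, v; split=> // p hp.
have spnD p1 p2 : spn r v p1 -> spn r v p2 -> spn r v (p1 + p2).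
  move=> [a1 h1] [a2 h2]; exists (fun l => a1 l + a2 l).
  under eq_bigr do rewrite scalerDl.
  by rewrite big_split /= opprD addrACA; apply: ID.
have spnZ k p1 : spn r v p1 -> spn r v (k *: p1).
  move=> [a1 h1]; exists (fun l => k * a1 l).
  under eq_bigr do rewrite -scalerA.
  by rewrite -scaler_sumr -scalerBr; apply: IZ.
rewrite -/(spn r v p) [p]mpolyE big_seq.
elim/big_ind: _ => [|? ?|m mp].
- by exists (fun=> 0); rewrite big1 ?subr0 // => l _; rewrite scale0r.
- exact: spnD.
- apply/spnZ/gv/mapP.
  have dm : mdeg m = d by apply: (dhomog_mf hp).
  have lm : (mdeg m < d.+1)%N by rewrite dm.
  by exists (BMultinom lm); rewrite ?mem_enum ?inE //= dm eqxx.
Qed.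

Lemma quot_dimP (d : nat) :
  exists v : 'I_(quot_dim I d) -> {mpoly K[N]}, quot_basis I d v.
Proof. exact: (epsilon_spec (inhabits 0%N)) (quot_dim_exists d). Qed.

Lemma quot_dim_eq (d r : nat) (v : 'I_r -> {mpoly K[N]}) :
  quot_basis I d v -> quot_dim I d = r.
Proof.
move=> bv; have [w bw] := quot_dimP d.
by apply/eqP; rewrite eqn_leq (quot_basis_le bw bv) (quot_basis_le bv bw).
Qed.

End QuotDim.

(* Bivariate series in Z[[s,t]] are given by their coefficients: [H n d] is the
   coefficient of s^n t^d. In {poly {poly int}} the outer variable is s and the
   inner one is t. *)
Definition hilbert_series (K : fieldType) (c : nat)
    (I : forall n : nat, polyKX K c n -> Prop) : nat -> nat -> int :=
  fun n d => (quot_dim (I n) d)%:Z.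

Definition series_of_poly (g : {poly {poly int}}) : nat -> nat -> int :=
  fun n d => g`_n`_d.

Definition series_mul (F G : nat -> nat -> int) : nat -> nat -> int :=
  fun n d => \sum_(p < n.+1) \sum_(q < d.+1) F p q * G (n - p)%N (d - q)%N.

(* H = g / D in Z[[s,t]] (the denominators considered here have constant
   coefficient 1, hence are invertible there). *)
Definition is_rational_fun (H : nat -> nat -> int) (g D : {poly {poly int}}) : Prop :=
  forall n d : nat, series_mul (series_of_poly D) H n d = series_of_poly g n d.

(* (1-t)^a * prod_j [(1-t)^(c_j) - s * f_j(t)] *)
Definition hilbert_denom (a b : nat) (e : 'I_b -> nat) (f : 'I_b -> {poly int}) :
    {poly {poly int}} :=
  ((1 - 'X) ^+ a)%:P * \prod_(j < b) (((1 - 'X) ^+ e j)%:P - 'X * (f j)%:P).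

(* Main.v *)
Require Import Defs.
From Stdlib Require Import ClassicalEpsilon FunctionalExtensionality.
From mathcomp Require Import all_boot all_order all_algebra zify.
From mathcomp.multinomials Require Import mpoly.

Set Implicit Arguments.
Unset Strict Implicit.
Unset Printing Implicit Defensive.

Import Order.TTheory GRing.Theory Num.Theory.
Local Open Scope ring_scope.

(** Write a monomial of K[X_n] as a word of length n whose k-th letter is the
column of exponents of x_{1,k}, ..., x_{c,k}, an element of N^c.  The leading
monomials of the ideals I_n, for the degree-lexicographic order, form a
language L, and the words outside L are bases of the quotients K[X_n]/I_n
([quot_dim_standard], [quot_dim_words]); so the Hilbert series counts these
words by length and total degree.

Multiplication by variables makes L stable under raising letters.  The shifts
in Inc(N)^i preserve the monomial order, hence commute with taking leading
monomials, and so L is also stable under inserting letters after the first i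
ones ([lead_lang_upclosed]).  By Higman's lemma ([higman], [wqo_emb]) inclusion
of such languages satisfies the ascending chain condition ([lang_ind]).

Cutting off the first letter a of a word gives
  H_L = [1 if L misses the empty word] + s * sum_a t^|a| H_(a^-1 L),
where a^-1 L increases with a ([lang_series_rec]).  If i > 0, the languages
a^-1 L are stable for i - 1 in place of i, and an induction on i applies.  If
i = 0, they all contain L.  For the letters a with a^-1 L larger than L,
Noetherian induction applies.  The letters with a^-1 L = L form a downward
closed set D in N^c, whose generating function is zero or p(t)/(1-t)^e with
e <= c and p(1) > 0.  Solving for H_L thus divides by 1 - s p(t)/(1-t)^e, which
is where the factors (1-t)^e - s p(t) of the denominator come from
([rational_lang_series]).

The sums over N^c are infinite, and both claims about them (rationality of the
sum, shape of the generating function of D) follow from the same slicing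
argument on c: along the first coordinate the summand is eventually constant by
the chain condition, so one more coordinate costs finitely many translates and
one division by 1 - t ([column_series_closed]). *)

(** * Well-quasi-orders and Higman's lemma *)

Section WellQuasiOrders.
Local Open Scope nat_scope.

Lemma dependent_choice (T : Type) (P : T -> Prop) (R : T -> T -> Prop) (x0 : T) :
    P x0 -> (forall x, P x -> exists y, P y /\ R x y) ->
  exists f : nat -> T, f 0 = x0 /\ forall n, P (f n) /\ R (f n) (f n.+1).
Proof.
move=> Px0 step.
have [g hg] : exists g : T -> T, forall x, P x -> P (g x) /\ R x (g x).
  have H x : {y | P x -> P y /\ R x y}.
    apply: constructive_indefinite_description.
    case: (classic (P x)) => [/step [y hy]|nPx]; first by exists y.
    by exists x.
  by exists (fun x => sval (H x)) => x; case: (H x).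
exists (fun n => iter n g x0); split=> // n.
have Pn : P (iter n g x0) by elim: n => //= n /hg [].
by split=> //; case: (hg _ Pn).
Qed.

Definition wqo (T : Type) (P : pred T) (R : rel T) : Prop :=
  forall x : nat -> T, (forall n, P (x n)) ->
  exists i j, i < j /\ R (x i) (x j).

Lemma increasing_from_step (f : nat -> nat) :
  (forall n, f n < f n.+1) -> forall i j, i < j -> f i < f j.
Proof.
by move=> h; apply: (@ssrnat.homo_ltn _ f (fun a b => a < b)) => //; apply: ltn_trans.
Qed.

(** Only finitely many terms of the sequence can have no later term above them:
infinitely many would form a sequence without a good pair.  Past those, one can
climb forever, and transitivity turns the climb into a monotone subsequence. *)
Lemma wqo_subseq (T : Type) (P : pred T) (R : rel T) (x : nat -> T) :
    transitive R -> wqo P R -> (forall n, P (x n)) ->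
  exists phi : nat -> nat,
    forall i j, i < j -> phi i < phi j /\ R (x (phi i)) (x (phi j)).
Proof.
move=> trR wR Px.
pose terminal n := forall m, n < m -> ~~ R (x n) (x m).
have [N hN] : exists N, forall n, N <= n -> ~ terminal n.
  apply: NNPP => nex.
  have gen N : exists n, N <= n /\ terminal n.
    apply: NNPP => h; apply: nex; exists N => n leNn tn.
    by apply: h; exists n.
  have [n0 [_ tn0]] := gen 0.
  have [|t [_ ht]] := @dependent_choice nat terminal (fun n m => n < m) n0 tn0.
    by move=> n _; have [m [ltnm tm]] := gen n.+1; exists m.
  have inc := increasing_from_step (fun n => proj2 (ht n)).
  have [i [j [ltij Rij]]] := wR (fun n => x (t n)) (fun n => Px _).
  by have /negP := proj1 (ht i) _ (inc _ _ ltij).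
have [|phi [_ hphi]] := @dependent_choice nat (fun n => N <= n)
    (fun n m => n < m /\ R (x n) (x m)) N (leqnn N).
  move=> n leNn; apply: NNPP => h; apply: (hN n leNn) => m ltnm.
  apply/negP => Rnm; apply: h; exists m; split=> //.
  exact: leq_trans leNn (ltnW ltnm).
exists phi => i j ltij.
have inc := increasing_from_step (fun n => proj1 (proj2 (hphi n))).
split; first exact: inc.
apply: (@ssrnat.homo_ltn _ (fun n => x (phi n)) R) => // n.
by case: (hphi n) => _ [].
Qed.

(** Stated for two sequences instead of one sequence of pairs, which is the form
in which Dickson's lemma and the chain conditions below use it. *)
Lemma wqo_pair (T U : Type) (P : pred T) (Q : pred U) (R : rel T) (S : rel U)
    (x : nat -> T) (y : nat -> U) :
    transitive R -> wqo P R -> wqo Q S ->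
    (forall n, P (x n)) -> (forall n, Q (y n)) ->
  exists i j, [/\ i < j, R (x i) (x j) & S (y i) (y j)].
Proof.
move=> trR wR wS Px Qy; have [phi hphi] := wqo_subseq trR wR Px.
have [i [j [ltij Sij]]] := wS (fun n => y (phi n)) (fun n => Qy _).
by exists (phi i), (phi j); case: (hphi i j ltij).
Qed.

Lemma wqo_nat : wqo predT leq.
Proof.
move=> x _; apply: NNPP => h.
have dec n : x n.+1 < x n.
  by rewrite ltnNge; apply/negP => le; apply: h; exists n, n.+1.
have bnd n : x n + n <= x 0 by elim: n => [|n IHn]; [lia | have := dec n; lia].
by have := bnd (x 0).+1; lia.
Qed.

Definition col_le : rel (seq nat) := all2 leq.

Lemma col_le_refl : reflexive col_le.
Proof. by elim=> //= a s ->; rewrite leqnn. Qed.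

Lemma col_le_trans : transitive col_le.
Proof.
elim=> [|b v IH] [|a u] [|e w] //= /andP[ab uv] /andP[be vw].
by rewrite (leq_trans ab be) (IH u w).
Qed.

(** Restricting to columns of one fixed size is essential: [col_le] relates only
columns of equal size, so it is not a well-quasi-order on all of [seq nat]. *)
Lemma dickson c : wqo (fun a => size a == c) col_le.
Proof.
elim: c => [|c IHc] x hx.
  by exists 0, 1; move: (hx 0) (hx 1) => /nilP -> /nilP ->.
have hb n : size (behead (x n)) == c by rewrite size_behead (eqP (hx n)).
have [i [j [ltij le1 le2]]] := wqo_pair (x := fun n => head 0 (x n))
  leq_trans wqo_nat IHc (fun=> isT) hb.
exists i, j; split=> //.
by move: (hx i) (hx j) le1 le2; case: (x i) (x j) => [|a u] [|b v] //= _ _ -> ->.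
Qed.

Section Embedding.
Variables (T : Type) (P : pred T) (R : rel T).
Hypotheses (trR : transitive R) (wR : wqo P R).

Fixpoint emb0 (u v : seq T) : bool :=
  if v is b :: v' then
    emb0 u v' || (if u is a :: u' then R a b && emb0 u' v' else true)
  else nilp u.

(** Subword embedding that matches the first [i] letters position by position,
as the shifts fixing 1, ..., i do.  A word with fewer than [i] letters embeds
exactly in the words having a prefix above it. *)
Fixpoint emb (i : nat) (u v : seq T) : bool :=
  if i is i'.+1 then
    match u, v with
    | [::], _ => true
    | a :: u', b :: v' => R a b && emb i' u' v'
    | _, _ => false
    end
  else emb0 u v.

Lemma emb0_nil v : emb0 [::] v.
Proof. by case: v => //= b v; rewrite orbT. Qed.

Let bad (x : nat -> seq T) : Prop :=
  (forall n, all P (x n)) /\ forall i j, i < j -> ~~ emb0 (x i) (x j).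

(** Nash-Williams: choose the terms one after the other, the n-th of least
length among the bad sequences continuing the terms already chosen.  The limit
is again bad, because badness involves only two terms at a time. *)
Lemma minimal_bad_sequence x0 : bad x0 ->
  exists2 x, bad x & forall n y, bad y -> (forall k, k < n -> y k = x k) ->
    size (x n) <= size (y n).
Proof.
move=> bad0.
pose admissible n f y := bad y /\ forall k, k < n -> y k = f k.
have [step hstep] : exists step : nat -> (nat -> seq T) -> nat -> seq T,
    forall n f, bad f -> admissible n f (step n f) /\
      forall y, admissible n f y -> size (step n f n) <= size (y n).
  suff H n f : {g | bad f -> admissible n f g /\
      forall y, admissible n f y -> size (g n) <= size (y n)}.
    by exists (fun n f => sval (H n f)) => n f; case: (H n f).
  apply: constructive_indefinite_description.
  case: (classic (bad f)) => [badf|nbad]; last by exists f.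
  suff [g h] : exists g, admissible n f g /\
      forall y, admissible n f y -> size (g n) <= size (y n) by exists g.
  suff descend m g : size (g n) < m -> admissible n f g ->
      exists g, admissible n f g /\
        forall y, admissible n f y -> size (g n) <= size (y n).
    exact: (descend _ f (ltnSn _)).
  elim: m g => // m IHm g; rewrite ltnS => szg adg.
  case: (classic (forall y, admissible n f y -> size (g n) <= size (y n)))
    => [ming|]; first by exists g.
  move=> nmin; have [y nle] := not_all_ex_not _ _ nmin.
  have [ady /negP] := imply_to_and _ _ nle.
  by rewrite -ltnNge => lt; apply: (IHm y) => //; apply: leq_trans lt szg.
pose F := fix F n := if n is n'.+1 then step n' (F n') else x0.
have badF n : bad (F n) by elim: n => //= n /(hstep n) [[]].
pose x n := F n.+1 n.
have Fx m k : k < m -> F m k = x k.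
  elim: m => // m IHm; rewrite ltnS leq_eqVlt => /predU1P [->//|ltkm].
  by case: (hstep m _ (badF m)) => [[_ /(_ k ltkm)]] /= -> _; apply: IHm.
exists x.
  split=> [n|i j ltij]; first by case: (badF n.+1) => /(_ n).
  rewrite -(Fx j.+1 i) ?ltnS 1?ltnW //.
  by case: (badF j.+1) => _ /(_ i j ltij).
move=> n y bady yx; case: (hstep n _ (badF n)) => _; apply; split=> // k ltkn.
by rewrite yx // Fx.
Qed.

(** Cut off the first letters of a minimal bad sequence, along a subsequence on
which they increase.  A good pair among the tails would give one among the
original words, so the beheaded sequence, preceded by the initial terms of the
old one, is bad; its first beheaded term contradicts minimality. *)
Lemma higman : wqo (all P) emb0.
Proof.
move=> x0 Px0; apply: NNPP => nex.
have bad0 : bad x0.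
  by split=> // i j ltij; apply/negP => e; apply: nex; exists i, j.
have [x [Px nemb] minx] := minimal_bad_sequence bad0.
case E0 : (x 0) => [|t0 w0].
  by have := nemb 0 1 isT; rewrite E0 emb0_nil.
have hx n : exists a w, x n = a :: w.
  case E : (x n) => [|a w]; last by exists a, w.
  by have := nemb n n.+1 (leqnn _); rewrite E emb0_nil.
pose a n := head t0 (x n); pose w n := behead (x n).
have xE n : x n = a n :: w n by rewrite /a /w; case: (hx n) => b [v ->].
have Pa n : P (a n) by have := Px n; rewrite xE => /andP[].
have Pw n : all P (w n) by have := Px n; rewrite xE => /andP[].
have [phi hphi] := wqo_subseq trR wR Pa.
pose y k := if k < phi 0 then x k else w (phi (k - phi 0)).
have phi0 k : phi 0 <= phi k.
  by case: k => // k; apply/ltnW; case: (hphi 0 k.+1 isT).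
have bady : bad y.
  split=> [n|i j ltij]; rewrite /y; first by case: ifP.
  case: ltnP => li; case: ltnP => lj.
  - exact: nemb.
  - apply/negP => e; have /negP := nemb i (phi (j - phi 0)) (leq_trans li (phi0 _)).
    by apply; rewrite [x (phi _)]xE /= e.
  - by have := leq_ltn_trans li (ltn_trans ltij lj); rewrite ltnn.
  - have /hphi [lt Ra] : i - phi 0 < j - phi 0 by lia.
    apply/negP => e; have /negP := nemb _ _ lt; apply.
    by rewrite xE [x (phi (j - _))]xE /= Ra e orbT.
have: size (x (phi 0)) <= size (y (phi 0)).
  by apply: minx => // k ltk; rewrite /y ltk.
by rewrite /y ltnn subnn xE /= ltnn.
Qed.

Lemma wqo_emb i : wqo (all P) (emb i).
Proof.
elim: i => [|i IHi] x Px; first exact: higman.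
case: (classic (exists n, x n = [::])) => [[n xn]|nnil].
  by exists n, n.+1; rewrite /= xn.
have hx n : exists a w, x n = a :: w.
  by case E : (x n) => [|a w]; [case: nnil; exists n | exists a, w].
have [a0 _] := hx 0.
pose a n := head a0 (x n); pose w n := behead (x n).
have xE n : x n = a n :: w n by rewrite /a /w; case: (hx n) => b [v ->].
have Pa n : P (a n) by have := Px n; rewrite xE => /andP[].
have Pw n : all P (w n) by have := Px n; rewrite xE => /andP[].
have [k [l [ltkl Ra ew]]] := wqo_pair trR wR IHi Pa Pw.
by exists k, l; rewrite !xE /= Ra ew.
Qed.
End Embedding.
End WellQuasiOrders.
(** * Languages of words stable under raising and inserting letters *)

Section Languages.
Local Open Scope nat_scope.

Definition lang := seq (seq nat) -> Prop.

Definition word c : pred (seq (seq nat)) := all (fun a => size a == c).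

(** The two elementary moves that generate the order [emb col_le i]; insertion at
the very end is always allowed, since it moves no letter. *)
Definition upclosed (i : nat) (L : lang) : Prop :=
  (forall u b v, i <= size u \/ v = [::] -> L (u ++ v) -> L (u ++ b :: v)) /\
  (forall u a b v, col_le a b -> L (u ++ a :: v) -> L (u ++ b :: v)).

Definition deriv (a : seq nat) (L : lang) : lang := fun w => L (a :: w).

(** Inclusion is tested only on words over columns of size [c], the words for
which the embedding order is a well-quasi-order; other words are never counted. *)
Definition lang_sub c (L M : lang) : Prop := forall w, word c w -> L w -> M w.

Lemma lang_sub_trans c L M N : lang_sub c L M -> lang_sub c M N -> lang_sub c L N.
Proof. by move=> LM MN w hw /LM - /(_ hw) /MN; apply. Qed.

Lemma upclosed_deriv i a L : upclosed i L -> upclosed i.-1 (deriv a L).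
Proof.
move=> [ins raise]; split=> [u b v h|u b d v]; last exact: (raise (a :: u)).
by apply: (ins (a :: u)); case: h => [h|->]; [left => /=; lia | right].
Qed.

Lemma lang_sub_deriv c a b i L : upclosed i L -> col_le a b ->
  lang_sub c (deriv a L) (deriv b L).
Proof. by move=> [_ raise] leab w _; apply: (raise [::]). Qed.

Lemma lang_sub_deriv0 c a L : upclosed 0 L -> lang_sub c L (deriv a L).
Proof. by move=> [ins _] w _; apply: (ins [::]); left. Qed.

Lemma upclosed_emb i L u v : upclosed i L -> emb col_le i u v -> L u -> L v.
Proof.
move=> [ins raise].
have ins_end p v' : L p -> L (p ++ v').
  elim: v' p => [|b v' IH] p Lp; first by rewrite cats0.
  by rewrite -cat_rcons; apply: IH; rewrite -cats1; apply: ins; [right | rewrite cats0].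
have emb0P p x y : i <= size p -> emb0 col_le x y -> L (p ++ x) -> L (p ++ y).
  elim: y p x => [|b y IH] p x lip /=; first by move=> /nilP ->.
  case/orP => [exy Lpx|]; first by apply: ins; [left | exact: IH exy Lpx].
  case: x => [_ Lp|a x /andP[leab exy] Lp]; first by rewrite cats0 in Lp; apply: ins_end.
  rewrite -cat_rcons; apply: (IH _ x) => //; first by rewrite size_rcons leqW.
  by rewrite cat_rcons; apply: raise leab Lp.
suff H k p x y : size p + k = i -> emb col_le k x y -> L (p ++ x) -> L (p ++ y).
  exact: (H i [::]).
elim: k p x y => [|k IH] p x y; first by rewrite addn0 => E; apply: emb0P; rewrite E.
case: x => [_ _|a x]; first by rewrite cats0; apply: ins_end.
case: y => [|b y] //= spk /andP[leab exy] Lp.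
rewrite -cat_rcons; apply: (IH _ x) => //; first by rewrite size_rcons addSnnS.
by rewrite cat_rcons; apply: raise leab Lp.
Qed.

Lemma wqo_words c i : wqo (word c) (emb col_le i).
Proof. exact: (wqo_emb col_le_trans (@dickson c)). Qed.

Lemma not_lang_sub c L M : ~ lang_sub c L M -> exists w, [/\ word c w, L w & ~ M w].
Proof.
move=> nsub; apply: NNPP => h; apply: nsub => w hw Lw.
by apply: NNPP => nMw; apply: h; exists w.
Qed.

(** The ascending chain condition as an induction principle.  In an infinite
strictly ascending chain pick a word witnessing each gap; a word embedded in a
later one forces that later word into its language too early. *)
Lemma lang_ind c i (P : lang -> Prop) :
    (forall L, upclosed i L ->
      (forall M, upclosed i M -> lang_sub c L M -> ~ lang_sub c M L -> P M) -> P L) ->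
  forall L, upclosed i L -> P L.
Proof.
move=> step L0 up0; apply: NNPP => nP0.
have [||F [_ hF]] := @dependent_choice lang
  (fun L => upclosed i L /\ ~ P L) (fun L M => lang_sub c L M /\ ~ lang_sub c M L) L0.
- by [].
- move=> L [upL nPL]; apply: NNPP => h; apply: nPL; apply: step => // M upM LM nML.
  by apply: NNPP => nPM; apply: h; exists M.
have mono m n : m <= n -> lang_sub c (F m) (F n).
  elim: n => [|n IH]; first by rewrite leqn0 => /eqP ->.
  rewrite leq_eqVlt => /predU1P [->//|/IH Fmn].
  by apply: lang_sub_trans Fmn _; case: (hF n) => _ [].
have gap n : exists w, [/\ word c w, F n.+1 w & ~ F n w].
  by apply: not_lang_sub; case: (hF n) => _ [].
have [w hw] : exists w, forall n, [/\ word c (w n), F n.+1 (w n) & ~ F n (w n)].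
  pose H n := constructive_indefinite_description _ (gap n).
  by exists (fun n => sval (H n)) => n; case: (H n).
have [m [n [ltmn e]]] : exists m n, m < n /\ emb col_le i (w m) (w n).
  by apply: (@wqo_words c i) => n; case: (hw n).
have [_ Fm _] := hw m; have [wn _ nFn] := hw n; apply: nFn.
apply: (mono m.+1 n) => //; have [[up _] _] := hF m.+1.
exact: upclosed_emb up e Fm.
Qed.

(** An increasing family of languages indexed by N^(d+1) is eventually constant
in its first index, uniformly in the others.  Otherwise there are arbitrarily
late columns and words witnessing growth, and a good pair for the product of
Dickson's order on columns and the embedding order on words is contradictory. *)
Lemma slices_stabilize c d i (F : seq nat -> lang) :
    (forall a, upclosed i (F a)) ->
    (forall a b, col_le a b -> lang_sub c (F a) (F b)) ->
  exists K, forall k a, K <= k -> size a = d ->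
    lang_sub c (F (k :: a)) (F (K :: a)).
Proof.
move=> upF monoF; apply: NNPP => nex.
have grow K : exists k a w, [/\ K <= k, size a = d, word c w,
    F (k :: a) w & ~ F (K :: a) w].
  apply: NNPP => h; apply: nex; exists K => k a leKk sa; apply: NNPP => nsub.
  by apply: h; have [w [hw Fw nFw]] := not_lang_sub nsub; exists k, a, w.
have [||x [_ hx]] := @dependent_choice (nat * (seq nat * seq (seq nat)))
  (fun x => size x.2.1 = d /\ word c x.2.2)
  (fun x y => [/\ x.1 <= y.1, F (y.1 :: y.2.1) y.2.2 & ~ F (x.1 :: y.2.1) y.2.2])
  (0, (nseq d 0, [::])).
- by rewrite /= size_nseq.
- move=> [K [a' w']] _; have [k [a [w [leKk sa hw Fw nFw]]]] := grow K.
  by exists (k, (a, w)).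
pose K n := (x n).1; pose a n := (x n.+1).2.1; pose w n := (x n.+1).2.2.
have leK m n : m <= n -> K m <= K n.
  apply: (@ssrnat.homo_leq _ K (fun p q => p <= q)) => [//||k]; first exact: leq_trans.
  by case: (hx k) => _ [].
have [m [n [ltmn leamn e]]] : exists m n,
    [/\ m < n, col_le (a m) (a n) & emb col_le i (w m) (w n)].
  apply: (wqo_pair col_le_trans (@dickson d) (@wqo_words c i)) => n.
  - by apply/eqP; case: (hx n.+1) => [[]].
  - by case: (hx n.+1) => [[]].
have [_ [_ Fm _]] := hx m; have [_ [_ _ nFn]] := hx n; apply: nFn.
have [[_ wn] _] := hx n.+1.
apply: (monoF (K m.+1 :: a m)) => //=; first by rewrite leamn andbT; apply: leK.
exact: upclosed_emb (upF _) e Fm.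
Qed.
End Languages.
(** * Bivariate series as a module over Z[s,t] *)

Section Series.

Definition series := nat -> nat -> int.

Definition series_add (F G : series) : series := fun n d => F n d + G n d.

Definition act (P : {poly {poly int}}) (H : series) : series :=
  series_mul (series_of_poly P) H.

Lemma eq_series (F G : series) : (forall n d, F n d = G n d) -> F = G.
Proof.
by move=> FG; do 2 (apply: functional_extensionality => ?); apply: FG.
Qed.

Lemma series_mul_local (F F' G G' : series) n d :
    (forall p q, (p <= n)%N -> (q <= d)%N -> F p q = F' p q /\ G p q = G' p q) ->
  series_mul F G n d = series_mul F' G' n d.
Proof.
move=> E; apply: eq_bigr => p _; apply: eq_bigr => q _.
have [lep leq] : (p <= n)%N /\ (q <= d)%N by rewrite -ltnS ltn_ord -ltnS ltn_ord.
by have [-> _] := E p q lep leq; have [_ ->] := E _ _ (leq_subr p n) (leq_subr q d).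
Qed.

Lemma series_mul_poly P Q n d :
  series_mul (series_of_poly P) (series_of_poly Q) n d = series_of_poly (P * Q) n d.
Proof.
rewrite /series_of_poly coefM coef_sum; apply: eq_bigr => p _.
by rewrite coefM.
Qed.

(** Each coefficient of a product depends on finitely many coefficients, so
identities between series follow from those of the polynomial ring through
truncations. *)
Definition trunc (N M : nat) (H : series) : {poly {poly int}} :=
  \poly_(n < N) \poly_(d < M) H n d.

Lemma truncE N M H n d : (n < N)%N -> (d < M)%N ->
  series_of_poly (trunc N M H) n d = H n d.
Proof. by move=> ltn ltd; rewrite /series_of_poly !coef_poly ltn coef_poly ltd. Qed.

Lemma act_trunc P H N M n d : (n < N)%N -> (d < M)%N ->
  act P H n d = series_of_poly (P * trunc N M H) n d.
Proof.
move=> ltn ltd; rewrite -series_mul_poly; apply: series_mul_local => p q lep leq.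
by rewrite truncE ?(leq_ltn_trans lep) ?(leq_ltn_trans leq).
Qed.

Lemma act_poly P Q : act P (series_of_poly Q) = series_of_poly (P * Q).
Proof. by apply: eq_series => n d; apply: series_mul_poly. Qed.

Lemma actM P Q H : act (P * Q) H = act P (act Q H).
Proof.
apply: eq_series => n d; rewrite (@act_trunc _ _ n.+1 d.+1) // -mulrA -series_mul_poly.
by apply: series_mul_local => p q lep leq; rewrite (@act_trunc _ _ n.+1 d.+1).
Qed.

Lemma actC P Q H : act P (act Q H) = act Q (act P H).
Proof. by rewrite -!actM mulrC. Qed.

Lemma act1 H : act 1 H = H.
Proof.
by apply: eq_series => n d; rewrite (@act_trunc _ _ n.+1 d.+1) // mul1r truncE.
Qed.

Lemma actDl P Q H : act (P + Q) H = series_add (act P H) (act Q H).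
Proof.
apply: eq_series => n d; rewrite /series_add !(@act_trunc _ _ n.+1 d.+1) //.
by rewrite mulrDl /series_of_poly !coefD.
Qed.

Lemma actDr P F G : act P (series_add F G) = series_add (act P F) (act P G).
Proof.
apply: eq_series => n d; rewrite /series_add /act /series_mul -big_split.
apply: eq_bigr => p _; rewrite -big_split; apply: eq_bigr => q _.
by rewrite mulrDr.
Qed.

Lemma series_of_polyD P Q :
  series_of_poly (P + Q) = series_add (series_of_poly P) (series_of_poly Q).
Proof. by apply: eq_series => n d; rewrite /series_of_poly /series_add !coefD. Qed.

Lemma act_sub P Q H G : act P H = series_add G (act Q H) -> act (P - Q) H = G.
Proof.
move=> E; have : series_add (act (P - Q) H) (act Q H) = series_add G (act Q H).
  by rewrite -actDl subrK.
move=> E'; apply: eq_series => n d; have := congr1 (fun F => F n d) E'.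
exact: addIr.
Qed.

Lemma act_s H : act 'X H = fun n d => if n is n'.+1 then H n' d else 0.
Proof.
apply: eq_series => n d; rewrite (@act_trunc _ _ n.+1 d.+1) //.
rewrite /series_of_poly coefXM; case: n => [|n] /=; first by rewrite coef0.
by rewrite -[RHS](@truncE n.+2 d.+1).
Qed.

Lemma act_t H : act 'X%:P H = fun n d => if d is d'.+1 then H n d' else 0.
Proof.
apply: eq_series => n d; rewrite (@act_trunc _ _ n.+1 d.+1) //.
rewrite /series_of_poly coefCM coefXM; case: d => [|d] //=.
by rewrite -[RHS](@truncE n.+1 d.+2).
Qed.

Definition series0 : series := fun _ _ => 0.

Lemma act0 P : act P series0 = series0.
Proof.
apply: eq_series => n d; rewrite /act /series_mul big1 // => p _.
by rewrite big1 // => q _; rewrite mulr0.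
Qed.

Lemma series_addr0 H : series_add H series0 = H.
Proof. by apply: eq_series => n d; rewrite /series_add addr0. Qed.
Lemma series_add0r H : series_add series0 H = H.
Proof. by apply: eq_series => n d; rewrite /series_add add0r. Qed.
Lemma series_addA F G H : series_add F (series_add G H) = series_add (series_add F G) H.
Proof. by apply: eq_series => n d; rewrite /series_add addrA. Qed.
Lemma series_addC F G : series_add F G = series_add G F.
Proof. by apply: eq_series => n d; rewrite /series_add addrC. Qed.

Variable c : nat.

(** The denominators allowed in the theorem, generated factor by factor so that
closure under products is a plain induction. *)
Inductive denom : {poly {poly int}} -> Prop :=
| denom_one : denom 1
| denom_t D : denom D -> denom ((1 - 'X)%:P * D)
| denom_f e f D : (e <= c)%N -> 0 < f.[1] -> denom D ->
    denom ((((1 - 'X) ^+ e)%:P - 'X * f%:P) * D).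

Lemma denom_mul D E : denom D -> denom E -> denom (D * E).
Proof.
move=> hD hE; elim: hD => [|D' _ IH|e f D' le pos _ IH]; rewrite ?mul1r -?mulrA //.
  exact: denom_t.
exact: denom_f.
Qed.

Lemma denom_hilbert D : denom D ->
  exists (a b : nat) (e : 'I_b -> nat) (f : 'I_b -> {poly int}),
  [/\ forall j, (e j <= c)%N, forall j, 0 < (f j).[1] & D = hilbert_denom a e f].
Proof.
elim=> {D} [|D _ [a [b [e [f [he hf ->]]]]]|e0 f0 D le0 pos0 _ [a [b [e [f [he hf ->]]]]]].
- exists 0%N, 0%N, (fun=> 0%N), (fun=> 0); split=> [[]//|[]//|].
  by rewrite /hilbert_denom big_ord0 expr0 mulr1.
- by exists a.+1, b, e, f; split=> //; rewrite /hilbert_denom mulrA -polyCM exprS.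
- exists a, b.+1, (fun j => oapp e e0 (unlift ord0 j)),
    (fun j => oapp f f0 (unlift ord0 j)).
  split=> [j|j|]; [by case: unlift.. | ].
  rewrite /hilbert_denom big_ord_recl unlift_none /= mulrCA; congr (_ * (_ * _)).
  by apply: eq_bigr => j _; rewrite liftK.
Qed.

Definition rational (H : series) : Prop :=
  exists D g, denom D /\ act D H = series_of_poly g.

Lemma rational_poly g : rational (series_of_poly g).
Proof. by exists 1, g; split; [exact: denom_one | rewrite act1]. Qed.

Lemma rational0 : rational series0.
Proof.
rewrite (_ : series0 = series_of_poly 0); first exact: rational_poly.
by apply: eq_series => n d; rewrite /series_of_poly !coef0.
Qed.

Lemma rational_add F G : rational F -> rational G -> rational (series_add F G).
Proof.
move=> [D [g [hD E]]] [D' [g' [hD' E']]].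
exists (D * D'), (D' * g + D * g'); split; first exact: denom_mul.
by rewrite actDr {1}[D * D']mulrC !actM E E' !act_poly series_of_polyD.
Qed.

Lemma rational_act P F : rational F -> rational (act P F).
Proof.
move=> [D [g [hD E]]]; exists D, (P * g); split=> //.
by rewrite -actM mulrC actM E act_poly.
Qed.

Lemma rational_div D F : denom D -> rational (act D F) -> rational F.
Proof.
move=> hD [E [g [hE eqg]]]; exists (E * D), g; split; first exact: denom_mul.
by rewrite actM.
Qed.

End Series.
(** * Sums over columns of exponents *)

Section LetterSums.
Variables (V : Type) (op : V -> V -> V) (idx : V).

(** The sum over all columns [a] of size [c] and total at most [d] of
[G a (d - sumn a)]: the coefficient of t^d in sum_a t^|a| G_a.  It is stated for
an arbitrary operation because it also enumerates words, with concatenation. *)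
Fixpoint column_sum (c : nat) (G : seq nat -> nat -> V) (d : nat) : V :=
  if c is c'.+1 then
    \big[op/idx]_(k < d.+1) column_sum c' (fun a => G (val k :: a)) (d - k)%N
  else G [::] d.

Lemma eq_column_sum c G G' d :
    (forall a e, size a = c -> (e <= d)%N -> G a e = G' a e) ->
  column_sum c G d = column_sum c G' d.
Proof.
elim: c G G' d => [|c IH] G G' d E /=; first exact: E.
apply: eq_bigr => k _; apply: IH => a e sa le; apply: E; first by rewrite /= sa.
exact: leq_trans le (leq_subr _ _).
Qed.
End LetterSums.

Lemma column_sum_morph (V V' : Type) (op : V -> V -> V) idx (op' : V' -> V' -> V') idx'
    (f : V -> V') c G d : {morph f : x y / op x y >-> op' x y} -> f idx = idx' ->
  f (column_sum op idx c G d) = column_sum op' idx' c (fun a e => f (G a e)) d.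
Proof.
move=> fM f0; elim: c G d => [|c IH] G d //=.
by rewrite (big_morph f fM f0); apply: eq_bigr => k _; apply: IH.
Qed.

Section SliceSums.

(** The series sum_k t^k G_k. *)
Definition slice_series (G : nat -> series) : series :=
  fun n d => \sum_(k < d.+1) G k n (d - k)%N.

Definition column_series (c : nat) (G : seq nat -> series) : series :=
  fun n d => column_sum +%R 0 c (fun a => G a n) d.

Lemma column_seriesS c G :
  column_series c.+1 G = slice_series (fun k => column_series c (fun a => G (k :: a))).
Proof. by []. Qed.

Lemma eq_column_series c G G' : (forall a, size a = c -> G a = G' a) ->
  column_series c G = column_series c G'.
Proof. by move=> E; apply: eq_series => n d; apply: eq_column_sum => a e /E ->. Qed.

Lemma column_series_add c G G' :
  column_series c (fun a => series_add (G a) (G' a)) =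
  series_add (column_series c G) (column_series c G').
Proof.
elim: c G G' => [|c IH] G G'; first by [].
rewrite !column_seriesS; apply: eq_series => n d; rewrite /series_add /slice_series -big_split.
by apply: eq_bigr => k _; rewrite IH.
Qed.

Lemma slice_series_recl G :
  slice_series G = series_add (G 0%N) (act 'X%:P (slice_series (fun k => G k.+1))).
Proof.
apply: eq_series => n d; rewrite /slice_series /series_add act_t big_ord_recl subn0.
by case: d => [|d]; rewrite ?big_ord0.
Qed.

(** This is sum_k t^k = 1/(1-t). *)
Lemma slice_series_const X : act (1 - 'X)%:P (slice_series (fun=> X)) = X.
Proof. by rewrite polyCB; apply: act_sub; rewrite act1 [LHS]slice_series_recl. Qed.

(** Closure properties of a class of series, graded by the number of coordinates
summed over, that make the slicing argument work.  The grading records how often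
1 - t has been inverted, which yields the bound e <= c. *)
Record slice_closed (C : nat -> series -> Prop) : Prop := SliceClosed {
  slice_mono : forall k X, C k X -> C k.+1 X;
  slice_add : forall k X Y, C k X -> C k Y -> C k (series_add X Y);
  slice_t : forall k X, C k X -> C k (act 'X%:P X);
  slice_const : forall k X, C k X -> C k.+1 (slice_series (fun=> X))
}.

(** The first [K] slices are finitely many translates, and the rest is a
geometric series. *)
Lemma slice_series_stable C k K G : slice_closed C -> (forall j, C k (G j)) ->
  (forall j, (K <= j)%N -> G j = G K) -> C k.+1 (slice_series G).
Proof.
move=> clC; elim: K G => [|K IH] G CG stab.
  rewrite (_ : G = fun=> G 0%N); first exact: slice_const.
  by apply: functional_extensionality => j; apply: stab.
rewrite slice_series_recl; apply: slice_add => //; first exact: slice_mono.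
apply: slice_t => //; apply: IH => // j leKj; exact: (stab j.+1).
Qed.

(** The slicing argument.  The summand depends on the column only through a
language increasing with it, which is what makes the slices stabilize. *)
Lemma column_series_closed C c i d (F : seq nat -> lang) (G : seq nat -> series) :
    slice_closed C ->
    (forall a, upclosed i (F a)) ->
    (forall a b, col_le a b -> lang_sub c (F a) (F b)) ->
    (forall a b, size a = d -> size b = d ->
      lang_sub c (F a) (F b) -> lang_sub c (F b) (F a) -> G a = G b) ->
    (forall a, size a = d -> C 0%N (G a)) ->
  C d (column_series d G).
Proof.
move=> clC; elim: d F G => [|d IH] F G upF monoF extG CG; first exact: (CG [::]).
rewrite column_seriesS; have [K hK] := slices_stabilize d upF monoF.
apply: (@slice_series_stable _ _ K) => // [k|k leKk].
  apply: (IH (fun a => F (k :: a))) => // [a b leab|a b sa sb|a sa].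
  - by apply: monoF; rewrite /= leqnn.
  - by apply: extG; rewrite /= ?sa ?sb.
  - by apply: CG; rewrite /= sa.
apply: eq_column_series => a sa; apply: extG; rewrite /= ?sa //; first exact: hK.
by apply: monoF; rewrite /= leKk col_le_refl.
Qed.
End SliceSums.

(** * Rationality of the series of a stable language *)

Section HilbertSeries.
Variable c : nat.

Definition outside (L : lang) : pred (seq (seq nat)) :=
  fun w => if excluded_middle_informative (L w) then false else true.

(** The number of words of length [n] and degree [d] outside [L], computed letter
by letter; [hilbert_countE] justifies the reading. *)
Fixpoint hilbert_count (n : nat) (L : lang) (d : nat) : int :=
  if n is n'.+1 then column_sum +%R 0 c (fun a => hilbert_count n' (deriv a L)) d
  else ((d == 0%N) && outside L [::])%:Z.

Definition lang_series (L : lang) : series := fun n d => hilbert_count n L d.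

Lemma eq_outside L M w : (L w <-> M w) -> outside L w = outside M w.
Proof. by rewrite /outside; do 2 case: excluded_middle_informative => //=; tauto. Qed.

Lemma eq_lang_series L M : lang_sub c L M -> lang_sub c M L ->
  lang_series L = lang_series M.
Proof.
move=> LM ML; apply: eq_series => n; rewrite /lang_series.
elim: n L M LM ML => [|n IH] L M LM ML d /=.
  by rewrite (@eq_outside L M) //; split; [apply: LM | apply: ML].
apply: eq_column_sum => a e sa _; apply: IH => w hw; first by apply: LM; rewrite /= sa eqxx.
by apply: ML; rewrite /= sa eqxx.
Qed.

Lemma lang_series_rec L :
  lang_series L = series_add (series_of_poly (outside L [::])%:Z%:P%:P)
    (act 'X (column_series c (fun a => lang_series (deriv a L)))).
Proof.
apply: eq_series => n d; rewrite /series_add act_s /lang_series /series_of_poly !coefC.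
case: n => [|n] /=; last by rewrite coef0 add0r.
by rewrite addr0 coefC; case: eqP.
Qed.

Lemma rational_closed : slice_closed (fun _ => rational c).
Proof.
split=> // [k X Y||k X rX]; [exact: rational_add | by move=> k X; apply: rational_act|].
apply: (@rational_div _ ((1 - 'X)%:P * 1)); first exact/denom_t/denom_one.
by rewrite mulr1 slice_series_const.
Qed.

(** Read X as h * H: then h is zero or p(t)/(1-t)^e with p(1) > 0 and e <= k.
Keeping the factor H inside means that only the action of polynomials on series
is ever needed, not a product of two series. *)
Definition positive_multiple (H : series) (k : nat) (X : series) : Prop :=
  X = series0 \/ exists e p, [/\ (e <= k)%N, (0 : int) < p.[1]
    & act ((1 - 'X) ^+ e)%:P X = act p%:P H].

(** Positivity survives addition: over the common denominator (1-t)^max(e,e') the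
numerator at 1 keeps the contribution of the summand of larger pole order, and
the other contributes nothing or a positive number. *)
Lemma positive_multiple_closed H : slice_closed (positive_multiple H).
Proof.
split=> [k X|k X Y|k X|k X].
- by case=> [->|[e [p [le pos E]]]]; [left | right; exists e, p; rewrite leqW].
- case=> [->|[e [p [le pos E]]]]; first by rewrite series_add0r.
  case=> [->|[e' [p' [le' pos' E']]]].
    by rewrite series_addr0; right; exists e, p.
  right; pose m := maxn e e'.
  exists m, ((1 - 'X) ^+ (m - e) * p + (1 - 'X) ^+ (m - e') * p'); split.
  + by rewrite geq_max le.
  + rewrite hornerD !hornerM !horner_exp !hornerE subrr !expr0n !subn_eq0.
    rewrite /m !geq_max !leqnn andbT /=; case: (leqP e' e) => [_|/ltnW ->] /=.
      by rewrite mul1r; case: (e <= e')%N; rewrite ?mul1r ?mul0r ?addr0 ?addr_gt0.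
    by rewrite mul0r add0r mul1r.
  + rewrite actDr polyCD actDl !polyCM !actM -E -E' -!actM -!polyCM -!exprD.
    by rewrite !subnK ?leq_maxl ?leq_maxr.
- case=> [->|[e [p [le pos E]]]]; first by left; rewrite act0.
  right; exists e, ('X * p); split=> //; first by rewrite hornerM hornerX mul1r.
  by rewrite actC E polyCM actM.
- case=> [->|[e [p [le pos E]]]].
    by left; apply: eq_series => n d; rewrite /slice_series big1.
  right; exists e.+1, p; split=> //.
  by rewrite exprSr polyCM actM slice_series_const.
Qed.

(** Induction on [i], and for i = 0 Noetherian induction on L.  [G1] collects the
letters a with a^-1 L = L, which contribute a multiple of H_L itself; [G2] the
others, whose languages are strictly larger than L. *)
Lemma rational_lang_series i L : upclosed i L -> rational c (lang_series L).
Proof.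
elim: i L => [|i IHi] L upL; last first.
  rewrite lang_series_rec; apply: rational_add; first exact: rational_poly.
  apply: rational_act.
  apply: (@column_series_closed (fun=> rational c) c i c (fun a => deriv a L)).
  - exact: rational_closed.
  - by move=> a; apply: (upclosed_deriv a upL).
  - by move=> a b leab; apply: (lang_sub_deriv upL leab).
  - by move=> a b _ _; apply: eq_lang_series.
  - by move=> a _; apply: IHi; apply: (upclosed_deriv a upL).
apply: (lang_ind (c := c) (i := 0%N) (P := fun L => rational c (lang_series L))) upL.
move=> {}L upL IH.
pose fixes a := excluded_middle_informative (lang_sub c (deriv a L) L).
pose G1 a := if fixes a then lang_series L else series0.
pose G2 a := if fixes a then series0 else lang_series (deriv a L).
have upd a : upclosed 0 (deriv a L) := upclosed_deriv a upL.
have monod a b (leab : col_le a b) :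
  lang_sub c (deriv a L) (deriv b L) := lang_sub_deriv upL leab.
have subd a : lang_sub c L (deriv a L) by apply: lang_sub_deriv0.
have splitG : column_series c (fun a => lang_series (deriv a L)) =
    series_add (column_series c G1) (column_series c G2).
  rewrite -column_series_add; apply: eq_column_series => a _; rewrite /G1 /G2.
  by case: (fixes a) => [sub|nsub]; rewrite ?series_addr0 ?series_add0r //;
    apply: eq_lang_series.
have rat2 : rational c (column_series c G2).
  apply: (@column_series_closed (fun=> rational c) c 0 c (fun a => deriv a L)) => //.
  - exact: rational_closed.
  - move=> a b _ _ ab ba; rewrite /G2; case: (fixes a) => ha; case: (fixes b) => hb //.
    + by case: hb; apply: lang_sub_trans ha.
    + by case: ha; apply: lang_sub_trans hb.
    + exact: eq_lang_series.
  - move=> a _; rewrite /G2; case: (fixes a) => ha; first exact: rational0.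
    exact: IH.
have : positive_multiple (lang_series L) c (column_series c G1).
  apply: (@column_series_closed (positive_multiple (lang_series L)) c 0 c
    (fun a => deriv a L)) => //.
  - exact: positive_multiple_closed.
  - move=> a b _ _ ab ba; rewrite /G1; case: (fixes a) => ha; case: (fixes b) => hb //.
    + by case: hb; apply: lang_sub_trans ha.
    + by case: ha; apply: lang_sub_trans hb.
  - move=> a _; rewrite /G1; case: (fixes a) => ha; last by left.
    by right; exists 0%N, 1; rewrite hornerC expr0 !act1.
have recL := lang_series_rec L; rewrite splitG in recL.
case=> [E1|[e [p [le pos E1]]]].
  rewrite recL E1 series_add0r; apply: rational_add; first exact: rational_poly.
  exact: rational_act.
(* H_L = c0 + s (h H_L + X2) with (1-t)^e h = p becomes
   ((1-t)^e - s p) H_L = (1-t)^e (c0 + s X2). *)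
apply: (@rational_div _ ((((1 - 'X) ^+ e)%:P - 'X * p%:P) * 1)).
  by apply: denom_f => //; apply: denom_one.
rewrite mulr1; set c0 := series_of_poly _ in recL.
rewrite (@act_sub _ _ _
  (act ((1 - 'X) ^+ e)%:P (series_add c0 (act 'X (column_series c G2))))).
  apply: rational_act; apply: rational_add; first exact: rational_poly.
  exact: rational_act.
by rewrite {1}recL [act ('X * _) _]actM -E1 [act 'X (act _ _)]actC !actDr -series_addA
  [series_add (act _ (act 'X (column_series c G2))) _]series_addC.
Qed.

End HilbertSeries.
(** * Enumeration of the words of given length and degree *)

Section WordEnumeration.
Variable c : nat.
Local Open Scope nat_scope.

Fixpoint words (n d : nat) : seq (seq (seq nat)) :=
  if n is n'.+1 then column_sum cat [::] c (fun a e => map (cons a) (words n' e)) d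
  else if d is 0 then [:: [::]] else [::].

Definition weight (w : seq (seq nat)) : nat := sumn (map sumn w).

Lemma hilbert_countE n L d : hilbert_count c n L d = (count (outside L) (words n d))%:Z.
Proof.
elim: n L d => [|n IH] L [|d] /=; rewrite ?addn0 //.
all: rewrite (column_sum_morph (op' := +%R) (idx' := 0%R)
  (f := fun s => (count (outside L) s)%:Z)) //; last by move=> s t; rewrite count_cat.
all: by apply: eq_column_sum => a e _ _; rewrite IH count_map.
Qed.

(** A summand supported at one column; used to compute multiplicities in the
enumeration of words. *)
Lemma column_sum_single (G : seq nat -> nat -> nat) a d :
    (forall b e, b != a -> G b e = 0) ->
  column_sum addn 0 c G d =
  if (size a == c) && (sumn a <= d) then G a (d - sumn a) else 0.
Proof.
elim: c G a d => [|c' IH] G [|k a] d G0 /=; rewrite ?subn0 //; first exact: G0.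
  rewrite big1 // => k _; rewrite (IH _ [::]) => [|b e _]; last exact: G0.
  by case: ifP => // _; apply: G0.
have Gk0 (k' : 'I_d.+1) : k' != k :> nat ->
    column_sum addn 0 c' (fun b => G (val k' :: b)) (d - k') = 0.
  move=> nek; rewrite (IH _ a) => [|b e _]; last by rewrite G0 // eqseq_cons (negbTE nek).
  by case: ifP => // _; rewrite G0 // eqseq_cons (negbTE nek).
case: (ltnP d k) => [ltdk|lekd].
  rewrite big1 => [|k' _]; last by apply: Gk0; have := ltn_ord k'; lia.
  by case: ifP => // /andP[_]; lia.
rewrite (bigD1 (Ordinal (lekd : k < d.+1))) //= big1 => [|k' nek]; last exact: Gk0.
rewrite (IH _ a) => [|b e ne]; last by rewrite G0 // eqseq_cons eqxx.
by rewrite addn0 eqSS subnDA leq_subRL.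
Qed.

Lemma count_mem_words w n d :
  count_mem w (words n d) = [&& size w == n, word c w & weight w == d].
Proof.
elim: n w d => [|n IH] w d.
  by case: d => [|d]; case: w => [|a w] //=; rewrite andbC.
rewrite [words _ _]/= (column_sum_morph (op' := addn) (idx' := 0)
  (f := fun s => count_mem w s)) //; last by move=> s t; rewrite count_cat.
case: w => [|a w].
  have nomem b e : count_mem [::] (map (cons b) (words n e)) = 0.
    by elim: (words n e) => //= v s ->.
  by rewrite (column_sum_single (a := [::])) => [|b e _]; rewrite nomem ?if_same.
rewrite (column_sum_single (a := a)) => [|b e ne]; last first.
  rewrite count_map -(count_pred0 (words n e)); apply: eq_count => v /=.
  by rewrite eqseq_cons (negbTE ne).
have -> e : count_mem (a :: w) (map (cons a) (words n e)) = count_mem w (words n e).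
  by rewrite count_map; apply: eq_count => v /=; rewrite eqseq_cons eqxx.
rewrite /= eqSS IH -/(word c w) /weight /= -/(weight w).
case: (size w == n); case: (size a == c); case: (word c w) => //=; rewrite ?if_same //.
by case: leqP => h; apply/esym; [|apply/eqP]; rewrite ?eqb0; lia.
Qed.

Lemma mem_words w n d :
  (w \in words n d) = [&& size w == n, word c w & weight w == d].
Proof. by rewrite -has_pred1 has_count count_mem_words lt0b. Qed.

Lemma words_uniq n d : uniq (words n d).
Proof.
by apply: count_mem_uniq => w; rewrite count_mem_words mem_words.
Qed.
End WordEnumeration.
(** * Leading monomials of a graded ideal *)

Section LeadingMonomials.
Variables (K : fieldType).

Definition leads (N : nat) (J : {mpoly K[N]} -> Prop) (m : 'X_{1..N}) : Prop :=
  exists p, [/\ J p, p != 0 & mlead p = m].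

Lemma leads_le N (J : {mpoly K[N]} -> Prop) m m' : is_ideal J ->
  (m <= m')%MM -> leads J m -> leads J m'.
Proof.
move=> [_ _ JM] le [p [Jp p0 mp]]; exists ('X_[m' - m] * p).
have X0 : 'X_[m' - m] != 0 :> {mpoly K[N]} by rewrite -msupp_eq0 msuppX.
by split; [apply: JM | rewrite mulf_neq0 | rewrite mleadM // mleadXm mp submK].
Qed.

Lemma mcoeff_pihomog N d (p : {mpoly K[N]}) m :
  (pihomog mdeg d p)@_m = if mdeg m == d then p@_m else 0.
Proof.
rewrite [p in LHS]mpolyE (raddf_sum (pihomog mdeg d)) (raddf_sum (mcoeff m)) /=.
rewrite [p in RHS]mpolyE raddf_sum /=.
transitivity (\sum_(m' <- msupp p) if mdeg m == d then (p@_m' *: 'X_[m'])@_m else 0).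
  apply: eq_bigr => m' _; rewrite linearZ /= pihomogX !mcoeffZ.
  case: (altP (mdeg m' =P d)) => [<-|nd]; rewrite ?mcoeffX ?mcoeff0.
    by case: (altP (m' =P m)) => [->|_]; rewrite ?eqxx // ?mulr0; case: ifP.
  rewrite mulr0; case: eqP => // dm; rewrite (_ : (m' == m) = false) ?mulr0 //.
  by apply: contraNF nd => /eqP ->; rewrite dm.
by case: ifP => // _; rewrite big1.
Qed.

Lemma mlead_lt N (p : {mpoly K[N]}) m : p != 0 -> p@_m = 0 ->
  (forall m', (m < m')%O -> p@_m' = 0) -> (mlead p < m)%O.
Proof.
move=> p0 pm pgt; rewrite ltNge le_eqVlt; apply/negP => /predU1P [E|/pgt /eqP].
  by move: p0; rewrite -mleadc_eq0 -E pm eqxx.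
by rewrite mleadc_eq0 (negbTE p0).
Qed.

(** Macaulay's theorem: the standard monomials, those that are not leading, form
a basis modulo the ideal.  They are independent because a nonzero combination
in the ideal would have a standard leading monomial.  They span because the
leading term of any polynomial can be cancelled, either by a standard monomial or
by an element of the ideal, which gradedness lets one take homogeneous. *)
Lemma quot_dim_standard N (J : {mpoly K[N]} -> Prop) d (s : seq 'X_{1..N}) :
    is_ideal J -> is_graded J -> uniq s ->
    (forall m, m \in s <-> mdeg m = d /\ ~ leads J m) ->
  quot_dim J d = size s.
Proof.
move=> idJ grJ us hs; have [J0 JD JM] := idJ.
have JZ (a : K) p : J p -> J (a *: p) by move=> Jp; rewrite -mul_mpolyC; apply: JM.
pose v (l : 'I_(size s)) : {mpoly K[N]} := 'X_[tnth (in_tuple s) l].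
have coefv (a : 'I_(size s) -> K) l : (\sum_k a k *: v k)@_(tnth (in_tuple s) l) = a l.
  rewrite raddf_sum (bigD1 l) //= big1 => [|k nekl].
    by rewrite mcoeffZ mcoeffX eqxx mulr1 addr0.
  rewrite mcoeffZ mcoeffX !(tnth_nth 0%MM) /= nth_uniq // (_ : (_ == _) = false) ?mulr0 //.
  exact: negbTE.
have homv l : v l \is d.-homog.
  by rewrite dhomogX; apply/eqP; case: (proj1 (hs _) (mem_tnth l (in_tuple s))).
apply: (quot_dim_eq idJ (v := v)); split=> // [a Ja l|p].
  have [p0|p0] := eqVneq (\sum_k a k *: v k) 0; first by rewrite -(coefv a l) p0 mcoeff0.
  suff ms : mlead (\sum_k a k *: v k) \in s.
    have [_ []] := proj1 (hs _) ms; exists (\sum_k a k *: v k); split=> //.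
  move: (mlead_supp p0); rewrite mcoeff_msupp; apply: contraR => nms.
  rewrite raddf_sum big1 // => k _ /=; rewrite mcoeffZ mcoeffX.
  case: eqP => [E|]; last by rewrite mulr0.
  by rewrite -E mem_tnth in nms.
pose spans p := exists a : 'I_(size s) -> K, J (p - \sum_l a l *: v l).
have spansD p1 p2 : spans p1 -> spans p2 -> spans (p1 + p2).
  move=> [a1 h1] [a2 h2]; exists (fun l => a1 l + a2 l).
  under eq_bigr do rewrite scalerDl.
  by rewrite big_split /= opprD addrACA; apply: JD.
have spansZ k p1 : spans p1 -> spans (k *: p1).
  move=> [a1 h1]; exists (fun l => k * a1 l).
  under eq_bigr do rewrite -scalerA.
  by rewrite -scaler_sumr -scalerBr; apply: JZ.
have spans0 : spans 0.
  by exists (fun=> 0); rewrite big1 ?subr0 // => l _; rewrite scale0r.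
rewrite -/(spans p); elim/mleadrect: p => p IH hp.
have [->//|p0] := eqVneq p 0.
have dp : mdeg (mlead p) = d by apply: (dhomog_mf hp); apply: mlead_supp.
have [r [hr sr r1 rgt]] : exists r, [/\ r \is d.-homog, spans r,
    r@_(mlead p) = 1 & forall m', (mlead p < m')%O -> r@_m' = 0].
  case: (classic (leads J (mlead p))) => [[q [Jq q0 mq]]|nl].
    exists ((mleadc q)^-1 *: pihomog mdeg d q); split.
    - exact/dhomogZ/pihomogP.
    - apply: spansZ; exists (fun=> 0); rewrite big1 ?subr0; first exact: grJ.
      by move=> l _; rewrite scale0r.
    - by rewrite mcoeffZ mcoeff_pihomog dp eqxx -mq mulVf // mleadc_eq0.
    - move=> m' lt; rewrite mcoeffZ mcoeff_pihomog.
      by rewrite [q@_m']mcoeff_gt_mlead ?mq // if_same mulr0.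
  have /tnthP [l El] : mlead p \in in_tuple s by apply/hs.
  exists 'X_[mlead p]; split.
  - by rewrite dhomogX; apply/eqP.
  - exists (fun k => (k == l)%:R); rewrite (bigD1 l) //= eqxx scale1r big1.
      by rewrite addr0 /v -El subrr.
    by move=> k /negbTE ->; rewrite scale0r.
  - by rewrite mcoeffX eqxx.
  - by move=> m' /lt_eqF; rewrite mcoeffX => ->.
pose p' := p - mleadc p *: r.
have -> : p = p' + mleadc p *: r by rewrite subrK.
apply: spansD; last exact: spansZ.
have [->//|p'0] := eqVneq p' 0.
apply: IH; last by rewrite rpredB // dhomogZ.
apply: mlead_lt => // [|m' lt]; rewrite mcoeffB mcoeffZ.
  by rewrite r1 mulr1 subrr.
by rewrite rgt // mulr0 subr0 mcoeff_gt_mlead.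
Qed.

(** A strictly increasing renaming of variables preserves the degree-lexicographic
order, hence commutes with taking leading monomials. *)
Section Renaming.
Variables (N N' : nat) (f : 'I_N -> 'I_N').
Hypothesis incf : forall k l : 'I_N, (k < l)%N -> (f k < f l)%N.

Let f_inj : injective f.
Proof.
move=> k l E; case: (ltngtP k l) => [ltkl|ltlk|/val_inj //].
  by have := incf ltkl; rewrite E ltnn.
by have := incf ltlk; rewrite E ltnn.
Qed.

(** Writing the exponents as sums over fibres avoids choosing a partial inverse of
[f]; each fibre has at most one element. *)
Definition rename_mnm (m : 'X_{1..N}) : 'X_{1..N'} :=
  [multinom (\sum_(l | f l == j) m l)%N | j < N'].

Lemma rename_mnm_im m l : rename_mnm m (f l) = m l.
Proof.
rewrite mnmE (bigD1 l) //= big1 ?addn0 // => k /andP[/eqP /f_inj ->].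
by rewrite eqxx.
Qed.

Lemma rename_mnm_notim m j : (forall l, f l != j) -> rename_mnm m j = 0%N.
Proof. by move=> nim; rewrite mnmE big1 // => l; rewrite (negbTE (nim l)). Qed.

Lemma rename_mnm_inj : injective rename_mnm.
Proof.
by move=> m m' E; apply/mnmP => l; rewrite -!rename_mnm_im E.
Qed.

Lemma mdeg_rename m : mdeg (rename_mnm m) = mdeg m.
Proof.
rewrite !mdegE; under eq_bigr do rewrite mnmE.
rewrite (exchange_big_dep predT) //=; apply: eq_bigr => l _.
by rewrite (big_pred1 (f l)).
Qed.

Lemma rename_mnm_lt m m' : (m < m')%O -> (rename_mnm m < rename_mnm m')%O.
Proof.
move=> lt; have := lemc_mdeg (ltW lt); rewrite leq_eqVlt => /predU1P [E|ltd]; last first.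
  by apply: lt_mdeg_ltmc; rewrite !mdeg_rename.
have /ltmcP -/(_ E) [l eql ltl] := lt.
apply/ltmcP; first by rewrite !mdeg_rename.
exists (f l); last by rewrite !rename_mnm_im.
move=> j ltj; case: (pickP (fun k => f k == j)) => [k /eqP Ek|nim].
  rewrite -Ek !rename_mnm_im; apply: eql; rewrite ltnNge leq_eqVlt.
  apply/negP => /predU1P [/val_inj E'|/incf]; move: ltj; rewrite -Ek.
    by rewrite E' ltnn.
  by move=> /ltnW; rewrite leqNgt => /negbTE ->.
by rewrite !rename_mnm_notim // => k; rewrite nim.
Qed.

Lemma rename_mnm_le m m' : (m <= m')%O -> (rename_mnm m <= rename_mnm m')%O.
Proof. by rewrite le_eqVlt => /predU1P [->//|/rename_mnm_lt /ltW]. Qed.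

Definition rename (p : {mpoly K[N]}) : {mpoly K[N']} := p \mPo [tuple 'X_(f l) | l < N].

Lemma renameE p : rename p = \sum_(m <- msupp p) p@_m *: 'X_[rename_mnm m].
Proof.
rewrite /rename comp_mpolyE; apply: eq_bigr => m _; congr (_ *: _).
(* Variables outside the image of f have exponent 0. *)
rewrite mpolyXE_id (bigID (fun j => [exists l, f l == j])) /=.
rewrite [X in _ = _ * X]big1 => [|j /existsPn nim]; last by rewrite rename_mnm_notim.
rewrite mulr1 (reindex_omap f (fun j => [pick l | f l == j])) /=; last first.
  move=> j /existsP [l /eqP <-]; case: pickP => [k /eqP E|/(_ l)]; first by rewrite /= E.
  by rewrite eqxx.
apply: eq_big => [l|l _]; last by rewrite tnth_mktuple rename_mnm_im.
apply/esym/andP; split; first by apply/existsP; exists l.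
case: pickP => [k /eqP /f_inj -> //|/(_ l)]; by rewrite eqxx.
Qed.

Lemma mcoeff_rename p m : (rename p)@_(rename_mnm m) = p@_m.
Proof.
rewrite renameE [p in RHS]mpolyE !raddf_sum; apply: eq_bigr => m' _ /=.
by rewrite !mcoeffZ !mcoeffX (inj_eq rename_mnm_inj).
Qed.

Lemma mlead_rename p : p != 0 ->
  rename p != 0 /\ mlead (rename p) = rename_mnm (mlead p).
Proof.
move=> p0; have cl : (rename p)@_(rename_mnm (mlead p)) != 0.
  by rewrite mcoeff_rename mleadc_eq0.
have r0 : rename p != 0 by apply: contraNneq cl => ->; rewrite mcoeff0.
split=> //; apply: le_anti; rewrite msupp_le_mlead ?mcoeff_msupp // andbT.
have := mlead_supp r0; rewrite mcoeff_msupp => nz.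
case: (classic (exists2 m, m \in msupp p & rename_mnm m = mlead (rename p))).
  by case=> m mp <-; apply/rename_mnm_le/msupp_le_mlead.
move: nz; set M := mlead (rename p) => nz nex; case/eqP: nz.
rewrite renameE raddf_sum big_seq big1 // => m mp /=.
rewrite mcoeffZ mcoeffX; case: eqP => [E|]; last by rewrite mulr0.
by case: nex; exists m.
Qed.
End Renaming.
End LeadingMonomials.
(** * Monomials as words *)

Section WordMonomials.

Lemma index_allpairs (T U : eqType) (s : seq T) (t : seq U) x y :
  x \in s -> y \in t ->
  index (x, y) [seq (a, b) | a <- s, b <- t] = (index x s * size t + index y t)%N.
Proof.
move=> + yt; elim: s => //= a s IH; rewrite inE index_cat size_map => xs.
have mem_row : ((x, y) \in [seq (a, b) | b <- t]) = (a == x).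
  apply/mapP/eqP => [[b _ [->//]]|->]; by exists y.
rewrite mem_row; case: eqP xs => [->|ne] xs.
  by rewrite eqxx mul0n index_map // => ? ? [].
by rewrite IH ?mulSn ?addnA //; case: eqP xs => // E; rewrite E in ne.
Qed.

(** The variables are numbered row by row, so that renamings which shift the
column index k are increasing. *)
Lemma mxvec_index_val c n (j : 'I_c) (k : 'I_n) : mxvec_index j k = (j * n + k)%N :> nat.
Proof.
have -> : mxvec_index j k = index (j, k) (enum {: 'I_c * 'I_n}) :> nat.
  have nthE := nth_enum_rank (j, k) (j, k).
  rewrite -[X in index X _]nthE index_uniq ?enum_uniq //= -cardE ltn_ord //.
rewrite enumT unlock /= /prod_enum index_allpairs ?mem_enum //.
by rewrite !index_enum_ord size_enum_ord.
Qed.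

Variable c : nat.

Definition word_mnm (n : nat) (w : seq (seq nat)) : 'X_{1..c * n} :=
  [multinom mxvec (\matrix_(j < c, k < n) nth 0%N (nth [::] w k) j) 0%R l
  | l < (c * n)%N].

Lemma word_mnmE n w (j : 'I_c) (k : 'I_n) :
  word_mnm n w (mxvec_index j k) = nth 0%N (nth [::] w k) j.
Proof. by rewrite mnmE mxvecE mxE. Qed.

Definition mnm_word (n : nat) (m : 'X_{1..c * n}) : seq (seq nat) :=
  [seq [seq m (mxvec_index j k) | j <- enum 'I_c] | k <- enum 'I_n].

Lemma mnm_wordK n m : word_mnm n (mnm_word m) = m.
Proof.
apply/mnmP => l; case/mxvec_indexP: l => j k; rewrite word_mnmE /mnm_word.
rewrite (nth_map k) ?size_enum_ord // nth_ord_enum.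
by rewrite (nth_map j) ?size_enum_ord // nth_ord_enum.
Qed.

Lemma size_mnm_word n (m : 'X_{1..c * n}) : size (mnm_word m) = n.
Proof. by rewrite size_map size_enum_ord. Qed.

Lemma word_mnm_word n (m : 'X_{1..c * n}) : word c (mnm_word m).
Proof. by apply/allP => a /mapP [k _ ->]; rewrite size_map size_enum_ord. Qed.

Lemma word_mnm_inj n w w' : size w = n -> size w' = n -> word c w -> word c w' ->
  word_mnm n w = word_mnm n w' -> w = w'.
Proof.
move=> sw sw' hw hw' E; apply: (@eq_from_nth _ [::]) => [|k]; first by rewrite sw.
rewrite sw => ltk; have sz v : size v = n -> word c v -> size (nth [::] v k) = c.
  by move=> sv /(all_nthP [::]) /(_ k); rewrite sv => /(_ ltk) /eqP.
apply: (@eq_from_nth _ 0%N) => [|j]; first by rewrite !sz.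
rewrite sz // => ltj.
by have := word_mnmE w (Ordinal ltj) (Ordinal ltk); rewrite E word_mnmE.
Qed.

Lemma mdeg_word_mnm n w : size w = n -> word c w -> mdeg (word_mnm n w) = weight w.
Proof.
move=> sw hw; rewrite mdegE (reindex _ (curry_mxvec_bij c n)) /=.
transitivity (\sum_(p : 'I_c * 'I_n) word_mnm n w (mxvec_index p.1 p.2))%N.
  by apply: eq_bigr => -[].
rewrite -(pair_bigA _ (fun j k => word_mnm n w (mxvec_index j k))) exchange_big /=.
rewrite /weight sumnE big_map (big_nth [::]) sw big_mkord; apply: eq_bigr => k _.
have /eqP sk : size (nth [::] w k) == c.
  by apply: (all_nthP [::] hw); rewrite sw.
rewrite sumnE (big_nth 0%N) sk big_mkord; apply: eq_bigr => j _.
exact: word_mnmE.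
Qed.

End WordMonomials.

(** * The language of leading monomials of a filtration *)

Section FiltrationLanguage.
Variables (K : fieldType) (c i : nat) (I : forall n : nat, polyKX K c n -> Prop).
Hypotheses (hI : inc_filtration i I) (hgr : forall n : nat, is_graded (@I n)).

Definition lead_lang : lang := fun w => leads (@I (size w)) (word_mnm c (size w) w).

Lemma lead_langE n w : size w = n -> lead_lang w <-> leads (@I n) (word_mnm c n w).
Proof. by move=> <-. Qed.

Lemma quot_dim_words n d :
  quot_dim (@I n) d = count (outside lead_lang) (words c n d).
Proof.
pose std := [seq w <- words c n d | outside lead_lang w].
rewrite -size_filter -/std -(size_map (word_mnm c n)).
have memstd w : w \in std <-> [/\ size w = n, word c w, weight w = d & ~ lead_lang w].
  rewrite mem_filter mem_words /outside.
  case: excluded_middle_informative => Lw /=; first by split=> // -[].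
  by split=> [/and3P [/eqP ? ? /eqP ?]|[-> -> -> _]]; rewrite ?eqxx.
apply: quot_dim_standard.
- exact: filtration_ideal hI n.
- exact: hgr.
- rewrite map_inj_in_uniq ?filter_uniq ?words_uniq // => w w'.
  by move=> /memstd [sw hw _ _] /memstd [sw' hw' _ _]; apply: word_mnm_inj.
move=> m; split=> [/mapP [w /memstd [sw hw dw nL] ->]|[dm nl]].
  by rewrite mdeg_word_mnm //; split=> // /(lead_langE sw).
apply/mapP; exists (mnm_word m); last by rewrite mnm_wordK.
have sm := size_mnm_word m; have wm := word_mnm_word m.
apply/memstd; split=> //; first by rewrite -(mdeg_word_mnm sm wm) mnm_wordK.
by move/(lead_langE sm); rewrite mnm_wordK.
Qed.

Lemma insert_bump u v (b : seq nat) k :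
  nth [::] (u ++ b :: v) (bump (size u) k) = nth [::] (u ++ v) k.
Proof.
rewrite !nth_cat /bump; case: (leqP (size u) k) => h.
  by rewrite ltnNge leqW //= add1n subSn.
by rewrite add0n h.
Qed.

(** Inserting an empty column at position [size u] is the effect on monomials of
the shift that skips the index [size u].+1.  The empty list serves as the zero
column because entries beyond the end of a list are read as 0. *)
Lemma lead_lang_insert u v : (i <= size u)%N \/ v = [::] ->
  lead_lang (u ++ v) -> lead_lang (u ++ [::] :: v).
Proof.
move=> pos; set m := size (u ++ v).
have sm : size (u ++ [::] :: v) = m.+1 by rewrite /m !size_cat addnS.
have ltu : (size u < m.+1)%N by rewrite ltnS /m size_cat leq_addr.
pose k0 := Ordinal ltu.
(* If u is shorter than i, then v is empty and the shift may skip a later index. *)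
have [t [leit bumpt]] : exists t, (i <= t)%N /\
    forall k, (k < m)%N -> bump t k = bump (size u) k.
  case: pos => [le|v0]; first by exists (size u).
  exists (maxn i (size u)); split=> [|k]; first exact: leq_maxl.
  by rewrite /m v0 cats0 /bump geq_max => ltk; rewrite [(size u <= k)%N]leqNgt ltk andbF.
pose pi k := (k + (t < k))%N.
have incpi : Inc_mn i m m.+1 pi.
  split; last by rewrite /pi; lia.
  by split=> [k l ltkl|k lek]; rewrite /pi; lia.
pose f (l : 'I_(c * m)) : 'I_(c * m.+1) :=
  mxvec (\matrix_(j < c, k < m) mxvec_index j (lift k0 k)) 0 l.
have fE j k : f (mxvec_index j k) = mxvec_index j (lift k0 k) by rewrite /f mxvecE mxE.
have incf (l l' : 'I_(c * m)) : (l < l')%N -> (f l < f l')%N.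
  case/mxvec_indexP: l => j k; case/mxvec_indexP: l' => j' k'; rewrite !fE !mxvec_index_val.
  have := ltn_ord k; have := ltn_ord k'; rewrite /= => lk' lk.
  have bk : (bump (size u) k < m.+1)%N := ltn_ord (lift k0 k).
  have bk' : (bump (size u) k' < m.+1)%N := ltn_ord (lift k0 k').
  case: (ltngtP j j') => [ltj _|ltj|->].
  - have : (j.+1 * m.+1 <= j' * m.+1)%N by rewrite leq_mul2r ltj orbT.
    by rewrite mulSn; lia.
  - have : (j'.+1 * m <= j * m)%N by rewrite leq_mul2r ltj orbT.
    by rewrite mulSn; lia.
  - by rewrite !ltn_add2l /bump; lia.
have actE p : inc_act m.+1 pi p = rename f p.
  rewrite /inc_act /rename; congr (_ \mPo _); apply: eq_from_tnth => l.
  rewrite !tnth_mktuple; case/mxvec_indexP: l => j k; rewrite mxvecE mxE fE /xvar.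
  have -> : pi k.+1 = (lift k0 k).+1 by rewrite /= -bumpt // /pi /bump; lia.
  by rewrite valK.
have lt_mm : (m <= m.+1)%N by [].
case=> p [Ip p0 mp]; apply/(lead_langE sm).
have [r0 mr] := mlead_rename incf p0.
exists (rename f p); split=> //; first by rewrite -actE; apply: (filtration_inc hI lt_mm incpi).
rewrite mr mp; apply/mnmP => l; case/mxvec_indexP: l => j k; rewrite word_mnmE.
case: (unliftP k0 k) => [k'|] ->.
  by rewrite -fE rename_mnm_im // word_mnmE insert_bump.
rewrite rename_mnm_notim => [|l]; last first.
  case/mxvec_indexP: l => j' k'; rewrite fE.
  apply/eqP => /(congr1 (mxvec (\matrix_(_ < c, k1 < m.+1) k1) 0)) /eqP.
  by rewrite !mxvecE !mxE eq_sym (negbTE (neq_lift _ _)).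
by rewrite nth_cat ltnn subnn nth_nil.
Qed.

Lemma lead_lang_upclosed : upclosed i lead_lang.
Proof.
have raise u a b v : (forall j, nth 0%N a j <= nth 0%N b j)%N ->
    lead_lang (u ++ a :: v) -> lead_lang (u ++ b :: v).
  move=> leab; set n := size (u ++ a :: v).
  have sb : size (u ++ b :: v) = n by rewrite /n !size_cat.
  move=> La; apply/(lead_langE sb).
  apply: leads_le La; first exact: filtration_ideal hI n.
  apply/mnm_lepP => l; case/mxvec_indexP: l => j k; rewrite !word_mnmE !nth_cat.
  by case: ifP => // _; case: (k - size u)%N.
split=> [u b v pos Luv|u a b v leab]; last first.
  apply: raise => j; elim: a b j leab => [|x a IH] [|y b] [|j] //= /andP[le leab] //.
  exact: IH.
apply: (raise u [::]); last exact: lead_lang_insert.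
by move=> j; rewrite nth_nil.
Qed.

End FiltrationLanguage.

Theorem proposition7p2 (K : fieldType) (c : nat) (hc : (1 <= c)%N) (i : nat)
    (I : forall n : nat, polyKX K c n -> Prop)
    (hI : inc_filtration i I)
    (hgr : forall n : nat, is_graded (I n)) :
  exists (a b : nat) (e : 'I_b -> nat) (f : 'I_b -> {poly int})
         (g : {poly {poly int}}),
    (forall j : 'I_b, (e j <= c)%N) /\
    (forall j : 'I_b, (0 : int) < (f j).[1]) /\
    is_rational_fun (hilbert_series I) g (hilbert_denom a e f).
Proof.
have [D [g [hD E]]] := rational_lang_series c (lead_lang_upclosed hI).
have [a [b [e [f [he hf ED]]]]] := denom_hilbert hD.
exists a, b, e, f, g; split=> //; split=> // n d.
rewrite -ED -E; apply: series_mul_local => p q _ _; split=> //.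
by rewrite /hilbert_series (quot_dim_words hI hgr) /lang_series hilbert_countE.
Qed.
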